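(* Let $q=q(n)$ be a sequence of positive integers such that $q=\omega\left(\frac{n}{\ln n}\right)$ and $q=n^{1+o(1)}$ as $n\to\infty$, i.e. $\frac{q(n)\ln n}{n}\to\infty$ and $\frac{\ln q(n)}{\ln n}\to 1$. Let $f(n,q)=\sup\{d \mid (d(q+1))^d<n^{d+1}\}$, where $d$ ranges over the positive real numbers. Then there are functions $\varepsilon_1(n),\varepsilon_2(n)\to 0$ (as $n\to\infty$) such that for every $n\ge 2$, in the Waiter-Client game on the edges of $K_n$ with bias $q=q(n)$: (i) Waiter has a strategy which forces Client's graph at the end of the game to have a vertex of degree at least $(1+\varepsilon_1(n))f(n,q)$; (ii) Client has a strategy which ensures that at the end of the game all vertices of his graph have degree at most $(1+\varepsilon_2(n))f(n,q)$.
   Context: The Waiter-Client game on the edges of $K_n$ with bias $q$ is a two-player perfect information game. In each round Waiter offers Client $q+1$ edges of $K_n$ that have not been previously offered; Client claims one of them and Waiter claims the remaining $q$. When fewer than $q+1$ not previously offered edges remain, Waiter claims all of them and the game ends. Client's graph is the graph on $V(K_n)$ formed by the edges claimed by Client. *)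

(* Defs.v *)
From mathcomp Require Import all_boot all_order all_algebra.
From mathcomp Require Import all_classical all_reals all_analysis.
Import Order.TTheory GRing.Theory Num.Theory.
Import numFieldNormedType.Exports.

Set Implicit Arguments.
Unset Strict Implicit.
Unset Printing Implicit Defensive.

(* A history lists the completed rounds, the most recent one first; a round is
   the pair of the set offered by Waiter and the element claimed by Client.
   Everything else that was offered, and what is left over at the end, goes to
   Waiter, so it need not be recorded. *)
Definition history (T : finType) := seq ({set T} * T).

Definition offered (T : finType) (h : history T) : {set T} :=
  \bigcup_(r <- h) r.1.

Definition client_claimed (T : finType) (h : history T) : {set T} :=
  [set x in [seq r.2 | r <- h]].

Definition unoffered (T : finType) (B : {set T}) (h : history T) : {set T} :=
  B :\: offered h.

Definition legal_offer (T : finType) (B : {set T}) (q : nat) (h : history T)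
    (A : {set T}) : bool :=
  (A \subset unoffered B h) && (#|A| == q.+1).

Definition game_over (T : finType) (B : {set T}) (q : nat) (h : history T) :
    bool :=
  #|unoffered B h| < q.+1.

Fixpoint legal_history (T : finType) (B : {set T}) (q : nat) (h : history T) :
    bool :=
  if h is (A, x) :: h' then
    [&& legal_history B q h', legal_offer B q h' A & x \in A]
  else true.

Definition waiter_strategy (T : finType) := history T -> {set T}.

Definition client_strategy (T : finType) := history T -> {set T} -> T.

Definition waiter_legal (T : finType) (B : {set T}) (q : nat)
    (sg : waiter_strategy T) : Prop :=
  forall h, legal_history B q h -> ~~ game_over B q h ->
    legal_offer B q h (sg h).

Definition client_legal (T : finType) (B : {set T}) (q : nat)
    (sg : client_strategy T) : Prop :=
  forall h A, legal_history B q h -> legal_offer B q h A -> sg h A \in A.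

Fixpoint waiter_follows (T : finType) (sg : waiter_strategy T)
    (h : history T) : bool :=
  if h is (A, x) :: h' then waiter_follows sg h' && (A == sg h') else true.

Fixpoint client_follows (T : finType) (sg : client_strategy T)
    (h : history T) : bool :=
  if h is (A, x) :: h' then client_follows sg h' && (x == sg h' A) else true.

Definition waiter_can_force (T : finType) (B : {set T}) (q : nat)
    (P : {set T} -> Prop) : Prop :=
  exists sg : waiter_strategy T, waiter_legal B q sg /\
    forall h, legal_history B q h -> game_over B q h -> waiter_follows sg h ->
      P (client_claimed h).

Definition client_can_ensure (T : finType) (B : {set T}) (q : nat)
    (P : {set T} -> Prop) : Prop :=
  exists sg : client_strategy T, client_legal B q sg /\
    forall h, legal_history B q h -> game_over B q h -> client_follows sg h ->
      P (client_claimed h).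

Definition complete_graph (n : nat) : {set {set 'I_n}} :=
  [set e : {set 'I_n} | #|e| == 2].

Definition degree (n : nat) (G : {set {set 'I_n}}) (v : 'I_n) : nat :=
  #|[set e in G | v \in e]|.

(* For [2 <= n] and [0 < q] the set below is nonempty and bounded above, so
   that [sup] is its genuine least upper bound. *)
Definition wc_threshold (R : realType) (n q : nat) : R :=
  sup [set d : R | 0 < d /\
    (d * q.+1%:R) `^ d < n%:R `^ (d + 1)]%R%classic.

(* Main.v *)
(** Write [Q = q + 1], [f = wc_threshold R n q] and [r = f Q / n]. The
    supremum is the solution of [f * ln r = ln n] with [r > 1], and the two
    hypotheses on [q] say that [r] and [f] tend to infinity.

    Client keeps the potential [\sum_v r^deg(v) * (1 + (r - 1) / Q)^free(v)]
    from increasing, where [free v] counts the edges at [v] not yet offered.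
    At most [n * exp ((r - 1) n / Q)] initially, it bounds every final
    degree by [(ln n + f) / ln r = (1 + 1 / ln r) f].

    Waiter splits the vertices into halves [X] and [Y] and reserves for each
    [v] in [X] and each level [i < k] a block of [b ~ n / (2k)] edges to [Y].
    Offering [q + 1] edges from the level-[i] blocks of [g ~ Q / b <= 8r]
    vertices of degree [i] forces Client to bring one of them to degree
    [i + 1]; hence [g^k <= n / 4] vertices suffice for degree [k], which
    allows [k] as large as [(1 - o(1)) ln n / ln r]. *)
Require Import Defs.
From mathcomp Require Import all_boot all_order all_algebra.
From mathcomp Require Import all_classical all_reals all_analysis.
From mathcomp Require Import zify ring lra.
(* Reinstates the finite-set lemmas that [classical_sets] shadows. *)
From mathcomp Require Import fintype finset.
Import Order.TTheory GRing.Theory Num.Theory.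
Import numFieldNormedType.Exports.

Set Implicit Arguments.
Unset Strict Implicit.
Unset Printing Implicit Defensive.

(** * Counting in finite sets *)

Lemma subset_of_card (T : finType) (A : {set T}) (m : nat) :
  m <= #|A| -> exists2 A' : {set T}, A' \subset A & #|A'| = m.
Proof.
case/card_geqP => s [us ss sA]; exists [set x in s].
  by apply/subsetP => x; rewrite inE => /sA.
by rewrite cardsE (card_uniqP us).
Qed.

(** If every level below [k] held at most [g - 1] vertices, the total weight would be at most [(g -
    1) * (1 + g + ... + g ^ (k - 1)) = g ^ k - 1]. *)
Lemma sum_expn_level (V : finType) (X : {set V}) (l : V -> nat) (g k : nat) :
    (forall v, v \in X -> l v < k) -> g ^ k <= \sum_(v in X) g ^ l v ->
  exists2 i, i < k & g <= #|[set v in X | l v == i]|.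
Proof.
move=> lk gk.
case: (pselect (exists i : 'I_k, g <= #|[set v in X | l v == i]|)).
  by case=> i gi; exists i.
move=> ng; case: k => [|k] in lk gk ng *.
  suff X0 : X = set0 by rewrite X0 big_set0 expn0 in gk.
  by apply/setP => v; rewrite inE; apply/negP => /lk.
suff : \sum_(v in X) g ^ l v < g ^ k.+1 by rewrite ltnNge gk.
have -> : \sum_(v in X) g ^ l v =
    \sum_(i < k.+1) #|[set v in X | l v == i]| * g ^ i.
  rewrite (partition_big (fun v => inord (l v) : 'I_k.+1) predT) //=.
  apply: eq_bigr => i _; rewrite -sum_nat_const big_mkcond [RHS]big_mkcond.
  apply: eq_bigr => v _; rewrite inE; case: (boolP (v \in X)) => //= vX.
  rewrite -val_eqE /= inordK ?lk //.
  by case: eqP => // ->.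
have sml (i : 'I_k.+1) : #|[set v in X | l v == i]| <= g.-1.
  rewrite -ltnS; case: g ng {gk} => [|g] ng; first by case: ng; exists ord0.
  by rewrite ltnNge; apply/negP => ?; case: ng; exists i.
have g0 : 0 < g by case: g ng {gk sml} => // ng; case: ng; exists ord0.
apply: (@leq_ltn_trans (\sum_(i < k.+1) g.-1 * g ^ i)).
  by apply: leq_sum => i _; rewrite leq_mul2r sml orbT.
by rewrite -big_distrr /= -predn_exp prednK ?expn_gt0 ?g0.
Qed.

(** * Strategies from invariants, and Waiter's box game *)

Section Game.
Variables (T : finType) (B : {set T}) (q : nat).
Implicit Types (h : history T) (A : {set T}).

Lemma offered_cons A x h : offered ((A, x) :: h) = A :|: offered h.
Proof. by rewrite /offered big_cons. Qed.

Lemma client_claimed_cons A x h :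
  client_claimed ((A, x) :: h) = x |: client_claimed h.
Proof. by apply/setP => y; rewrite !inE. Qed.

Lemma unoffered_cons A x h : unoffered B ((A, x) :: h) = unoffered B h :\: A.
Proof. by rewrite /unoffered offered_cons setUC setDDl. Qed.

Lemma client_claimed_offered h :
  legal_history B q h -> client_claimed h \subset offered h.
Proof.
elim: h => [_|[A x] h IHh /= /and3P[/IHh hs _ xA]].
  by apply/subsetP => y; rewrite !inE.
rewrite offered_cons client_claimed_cons subUset sub1set inE xA /=.
exact: subset_trans hs (subsetUr _ _).
Qed.

Lemma legal_offer_claimed h A x :
    legal_history B q h -> legal_offer B q h A -> x \in A ->
  x \notin client_claimed h.
Proof.
move=> hl /andP[/subsetP As _] /As; rewrite inE => /andP[xo _].
by apply: contra xo; apply/subsetP/client_claimed_offered.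
Qed.

(** The strategy chooses an offer after which [Inv] survives every reply. Legality is required on
    all legal histories, so [good] is conditional on [Inv h] and accepts any legal offer where [Inv]
    fails. *)
Lemma waiter_invariant (Inv : history T -> Prop) (P : {set T} -> Prop) :
  Inv [::] ->
  (forall h, legal_history B q h -> ~~ game_over B q h -> Inv h ->
     exists2 A, legal_offer B q h A & forall x, x \in A -> Inv ((A, x) :: h)) ->
  (forall h, legal_history B q h -> game_over B q h -> Inv h ->
     P (client_claimed h)) ->
  waiter_can_force B q P.
Proof.
move=> Inv0 step final.
pose good h A := legal_offer B q h A /\
  (Inv h -> forall x, x \in A -> Inv ((A, x) :: h)).
have goodE h : legal_history B q h -> ~~ game_over B q h -> exists A, good h A.
  move=> hl hg; case: (pselect (Inv h)) => [/(step h hl hg)[A hA AInv]|nInv].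
    by exists A.
  move: hg; rewrite /game_over -leqNgt => /subset_of_card[A As Ac].
  by exists A; split=> //; rewrite /legal_offer As Ac eqxx.
pose sg h := xget set0 (good h).
have sgP h : legal_history B q h -> ~~ game_over B q h -> good h (sg h).
  by move=> hl hg; case: (goodE h hl hg) => A hA; exact: (xgetI set0 hA).
exists sg; split=> [h hl hg|h hl hg hf]; first by case: (sgP h hl hg).
apply: final => //; elim: h hl hf {hg} => [//|[A x] h IHh].
move=> /= /and3P[hl hA xA] /andP[hf /eqP AE].
have hg : ~~ game_over B q h.
  case/andP: hA => As /eqP Ac.
  by rewrite /game_over -leqNgt -Ac subset_leq_card.
rewrite AE in xA *; case: (sgP h hl hg) => _; apply=> //; exact: IHh.
Qed.

(** The dual of [waiter_invariant]. The element [x0] is only the default of [xget]; a legal offer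
    always has a good reply. *)
Lemma client_invariant (x0 : T) (Inv : history T -> Prop)
    (P : {set T} -> Prop) :
  Inv [::] ->
  (forall h A, legal_history B q h -> legal_offer B q h A -> Inv h ->
     exists2 x, x \in A & Inv ((A, x) :: h)) ->
  (forall h, legal_history B q h -> Inv h -> P (client_claimed h)) ->
  client_can_ensure B q P.
Proof.
move=> Inv0 step final.
pose good h A x := x \in A /\ (Inv h -> Inv ((A, x) :: h)).
have goodE h A : legal_history B q h -> legal_offer B q h A ->
    exists x, good h A x.
  move=> hl hA; case: (pselect (Inv h)) => [/(step h A hl hA)[x xA xInv]|nInv].
    by exists x.
  case/andP: hA => _ /eqP Ac; have : 0 < #|A| by rewrite Ac.
  by case/card_gt0P => x xA; exists x.
pose sg h A := xget x0 (good h A).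
have sgP h A : legal_history B q h -> legal_offer B q h A -> good h A (sg h A).
  by move=> hl hA; case: (goodE h A hl hA) => x hx; exact: (xgetI x0 hx).
exists sg; split=> [h A hl hA|h hl _ hf]; first by case: (sgP h A hl hA).
apply: final => //; elim: h hl hf => [//|[A x] h IHh].
move=> /= /and3P[hl hA xA] /andP[hf /eqP xE].
by rewrite xE; case: (sgP h A hl hA) => _; apply; apply: IHh.
Qed.

(* A vertex [v] of [X] at level [l v] has weight [g ^ l v], and its boxes
   [J v i] with [l v <= i] are untouched. Offering only elements of the boxes
   of level [i] of [g] vertices at level [i] costs [g] vertices of weight
   [g ^ i] and yields one of weight [g ^ i.+1], so the total weight does not
   decrease until some vertex reaches level [k]. *)
Lemma waiter_can_force_box (V : finType) (b g k : nat) (X0 : {set V})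
    (J : V -> nat -> {set T}) :
  (forall v i, v \in X0 -> i < k -> J v i \subset B /\ b <= #|J v i|) ->
  (forall v w i j, v \in X0 -> w \in X0 -> i < k -> j < k ->
     (v, i) != (w, j) -> [disjoint J v i & J w j]) ->
  q < g * b -> g ^ k <= #|X0| ->
  waiter_can_force B q (fun G => exists2 v, v \in X0 &
    k <= #|G :&: \bigcup_(i < k) J v i|).
Proof.
move=> Jb Jdisj qgb gk.
pose D v := \bigcup_(i < k) J v i.
pose won h := exists2 v, v \in X0 & k <= #|client_claimed h :&: D v|.
pose state h := exists X : {set V}, exists l : V -> nat,
  [/\ X \subset X0, g ^ k <= \sum_(v in X) g ^ l v &
  forall v, v \in X -> [/\ l v <= k, l v <= #|client_claimed h :&: D v| &
    forall i, l v <= i < k -> [disjoint J v i & offered h]]].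
(* This serves twice: it supplies Waiter's move, and it shows that the game cannot be over before
   some vertex has won. *)
have advance h : legal_history B q h -> state h -> ~ won h ->
    exists2 A, legal_offer B q h A & forall x, x \in A -> state ((A, x) :: h).
  move=> hl [X [l [XX0 wX lX]]] nwon.
  have lk v : v \in X -> l v < k.
    move=> vX; have [lvk lvc _] := lX v vX.
    rewrite ltn_neqAle lvk andbT; apply/eqP => lE; apply: nwon.
    by exists v; [exact: (subsetP XX0)|rewrite -lE].
  have [i ik] := sum_expn_level lk wX.
  move=> /subset_of_card[Y YX Yc].
  have YP v : v \in Y -> (v \in X) /\ l v = i.
    by move=> /(subsetP YX); rewrite inE => /andP[-> /eqP].
  have YX0 v : v \in Y -> v \in X0 by case/YP => /(subsetP XX0).
  have gbU : q.+1 <= #|\bigcup_(v in Y) J v i|.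
    apply: leq_trans qgb _.
    suff -> : #|\bigcup_(v in Y) J v i| = \sum_(v in Y) #|J v i|.
      rewrite -Yc -sum_nat_const; apply: leq_sum => v vY.
      by have [] := Jb v i (YX0 v vY) ik.
    (* Empty sets outside [Y] make the boxes a pairwise disjoint family over all of [V]. *)
    pose F v := if v \in Y then J v i else set0.
    have -> : \bigcup_(v in Y) J v i = \bigcup_v F v.
      rewrite [LHS]big_mkcond /=; apply: eq_bigr => v _; exact: erefl.
    rewrite -sum1_card partition_disjoint_bigcup => [|v w vw].
      rewrite [RHS]big_mkcond; apply: eq_bigr => v _.
      by rewrite sum1_card /F; case: ifP => //; rewrite cards0.
    rewrite /F; case: ifP => vY; last by rewrite -setI_eq0 set0I.
    case: ifP => wY; last by rewrite -setI_eq0 setI0.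
    apply: Jdisj => //; try exact: YX0.
    by rewrite xpair_eqE (negbTE vw).
  have [A AU Ac] := subset_of_card gbU.
  have AJ x : x \in A -> exists2 v, v \in Y & x \in J v i.
    by move=> /(subsetP AU)/bigcupP.
  have Aun : A \subset unoffered B h.
    apply/subsetP => x /AJ[v vY xJ]; have [vX lv] := YP v vY.
    have [_ _ /(_ i)] := lX v vX; rewrite lv leqnn ik => /(_ isT) dis.
    rewrite inE (disjointFr dis xJ) /=.
    by have [/subsetP JB _] := Jb v i (YX0 v vY) ik; exact: JB.
  have hA : legal_offer B q h A by rewrite /legal_offer Aun Ac eqxx.
  exists A => // x xA; have [v vY xJ] := AJ x xA; have [vX lv] := YP v vY.
  have vX0 := YX0 v vY.
  (* Only [v] advances; the other vertices of [Y], whose boxes of level [i] may be spoilt, are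
     dropped. *)
  pose l' w := if w == v then i.+1 else l w.
  have vnXY : v \notin X :\: Y by rewrite inE vY.
  exists (v |: (X :\: Y)), l'; split.
  - by rewrite subUset sub1set vX0 (subset_trans (subsetDl _ _)).
  - rewrite big_setU1 //= /l' eqxx; apply: leq_trans wX _.
    rewrite (big_setID Y) /= (setIidPr _); last by apply/subsetP => w /YP[].
    apply: leq_add.
      rewrite (eq_bigr (fun=> g ^ i)) => [|w /YP[_ ->] //].
      by rewrite sum_nat_const Yc -expnS.
    apply: leq_sum => w; rewrite inE => /andP[wY _].
    by case: eqP => // wv; rewrite wv vY in wY.
  move=> w; rewrite !inE client_claimed_cons offered_cons => wv.
  have wX0 : w \in X0.
    by case/predU1P: wv => [->//|/andP[_]]; exact: (subsetP XX0).
  have Adis j : (forall u, u \in Y -> (w, j) != (u, i)) -> j < k ->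
      [disjoint J w j & A].
    move=> wju jk; rewrite disjoint_sym.
    apply/pred0P => y /=; apply/negP => /andP[/AJ[u uY yu]].
    by rewrite (disjointFl (Jdisj w u j i wX0 (YX0 u uY) jk ik (wju u uY)) yu).
  have disU j : [disjoint J w j & A] -> [disjoint J w j & offered h] ->
      [disjoint J w j & A :|: offered h].
    by rewrite -!setI_eq0 setIUr => /eqP-> /eqP->; rewrite setU0.
  case/predU1P: wv => [wv|/andP[wY wXr]].
    subst w; have [_ lvc lvd] := lX v vX; rewrite /l' eqxx; split=> //.
      have xD : x \in D v by apply/bigcupP; exists (Ordinal ik).
      have -> : (x |: client_claimed h) :&: D v =
          x |: (client_claimed h :&: D v).
        by rewrite setIUl (setIidPl _) // sub1set.
      by rewrite cardsU1 inE (negbTE (legal_offer_claimed hl hA xA)) /= -lv.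
    move=> j /andP[ij jk]; apply: disU; last by apply: lvd; rewrite lv ltnW.
    apply: Adis => // u _; rewrite xpair_eqE negb_and [j == i]eq_sym.
    by rewrite neq_ltn ij !orbT.
  have wnv : w != v by apply: contraNneq wY => ->.
  have [lwk lwc lwd] := lX w wXr; rewrite /l' (negbTE wnv); split=> //.
    by apply: leq_trans lwc _; rewrite subset_leq_card // setSI // subsetUr.
  move=> j /[dup] /lwd dj /andP[_ jk]; apply: disU => //.
  apply: Adis => // u uY; rewrite xpair_eqE negb_and.
  by apply/orP; left; apply: contraNneq wY => ->.
apply: (@waiter_invariant (fun h => won h \/ state h)).
- right; exists X0, (fun=> 0); split=> // [|v _].
    by rewrite sum_nat_const expn0 muln1.
  split=> // j _; rewrite -setI_eq0 /offered big_nil setI0 //.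
(* Client's set only grows, so a win persists and any legal offer will do after it. *)
- move=> h hl hg; case: (pselect (won h)) => [[v vX vk] _|nwon [//|hs]].
    move: hg; rewrite /game_over -leqNgt => /subset_of_card[A As Ac].
    exists A; first by rewrite /legal_offer As Ac eqxx.
    move=> x _; left; exists v => //; apply: leq_trans vk _.
    by rewrite subset_leq_card // client_claimed_cons setSI // subsetUr.
  have [A hA Ast] := advance h hl hs nwon.
  by exists A => // x /Ast; right.
- move=> h hl hg [//|hs]; case: (pselect (won h)) => // nwon.
  have [A /andP[As /eqP Ac] _] := advance h hl hs nwon.
  by move: hg; rewrite /game_over ltnNge -Ac subset_leq_card.
Qed.
End Game.

(** * Client's exponential potential *)

Local Open Scope ring_scope.

Lemma bernoulli_inequality (R : realFieldType) (x : R) (n : nat) :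
  0 <= x -> 1 + n%:R * x <= (1 + x) ^+ n.
Proof.
move=> x0; elim: n => [|n IHn]; first by rewrite mul0r addr0 expr0.
rewrite exprS; apply: le_trans (ler_wpM2l _ IHn); last by rewrite addr_ge0.
rewrite -natr1; have : 0 <= n%:R * x * x by rewrite !mulr_ge0.
by lra.
Qed.

(* Bernoulli: one offer multiplies the potential by at most [1] on average
   over Client's choices. *)
Lemma client_can_ensure_exp (R : realFieldType) (T I : finType) (B : {set T})
    (q : nat) (S : I -> {set T}) (t : R) : T -> 1 <= t ->
  client_can_ensure B q (fun G =>
    \sum_i t ^+ #|G :&: S i| <=
    \sum_i (1 + (t - 1) / q.+1%:R) ^+ #|B :&: S i|).
Proof.
move=> x0 t1; set c := 1 + _ / _.
have c1 : 1 <= c by rewrite lerDl divr_ge0 ?ler0n // subr_ge0.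
have t0 : 0 <= t by apply: le_trans t1.
pose w h i := t ^+ #|client_claimed h :&: S i| * c ^+ #|unoffered B h :&: S i|.
pose M := \sum_i c ^+ #|B :&: S i|.
apply: (@client_invariant _ _ _ x0 (fun h => \sum_i w h i <= M)).
- apply: ler_sum => i _; rewrite /w /unoffered /offered big_nil setD0.
  have -> : client_claimed [::] = set0 :> {set T}.
    by apply/setP => x; rewrite !inE.
  by rewrite set0I cards0 mul1r.
- move=> h A hl hA hM.
  (* If every choice exceeded [M], the sum over the [q + 1] choices would exceed [(q + 1) * M]. *)
  case: (pselect (exists2 x, x \in A & \sum_i w ((A, x) :: h) i <= M)) => // nx.
  suff : \sum_(x in A) \sum_i w ((A, x) :: h) i <= \sum_(x in A) M.
    case/andP: (hA) => _ /eqP Ac; rewrite leNgt => /negP[].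
    apply: ltr_sum => [|x xA].
      have /card_gt0P[x xA] : (0 < #|A|)%N by rewrite Ac.
      by apply/hasP; exists x; rewrite ?mem_index_enum.
    by rewrite ltNge; apply/negP => ?; apply: nx; exists x.
  case/andP: (hA) => As /eqP Ac; rewrite sumr_const Ac exchange_big /=.
  rewrite -[leRHS]mulr_natl; apply: le_trans (ler_wpM2l (ler0n _ _) hM).
  rewrite mulr_sumr; apply: ler_sum => i _.
  set a := #|A :&: S i|.
  set u := #|(unoffered B h :\: A) :&: S i|.
  have uE : #|unoffered B h :&: S i| = (u + a)%N.
    have -> : u = #|(unoffered B h :&: S i) :\: A| by rewrite /u setIDAC.
    have -> : a = #|(unoffered B h :&: S i) :&: A|.
      by rewrite /a setIAC (setIidPr As).
    by rewrite addnC cardsID.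
  have wE x : x \in A -> w ((A, x) :: h) i =
      t ^+ #|client_claimed h :&: S i| * c ^+ u * (if x \in S i then t else 1).
    move=> xA; rewrite /w client_claimed_cons unoffered_cons -/u mulrAC.
    congr (_ * c ^+ u); rewrite setIUl.
    case: ifP => xS.
      rewrite (setIidPl _) ?sub1set // cardsU1 inE.
      by rewrite (negbTE (legal_offer_claimed hl hA xA)) /= exprS mulrC.
    rewrite (_ : [set x] :&: S i = set0) ?set0U ?mulr1 //.
    by apply/setP => y; rewrite !inE; case: eqP => // ->; rewrite xS.
  rewrite (eq_bigr _ wE) -mulr_sumr /w uE exprD.
  rewrite [leRHS]mulrCA -!mulrA ler_wpM2l ?exprn_ge0 //.
  rewrite mulrCA ler_wpM2l ?exprn_ge0 ?(le_trans ler01) //.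
  (* With the common factors cancelled, [a] of the [q + 1] choices contribute [t] and the others
     [1]; Bernoulli compares this with [(q + 1) * c ^+ a]. *)
  have -> : \sum_(x in A) (if x \in S i then t else 1) =
      q.+1%:R * (1 + a%:R * (t - 1) / q.+1%:R).
    rewrite (big_setID (S i)) /= (eq_bigr (fun=> t)) => [|x]; last first.
      by rewrite inE => /andP[_ ->].
    rewrite [X in _ + X](eq_bigr (fun=> 1)) => [|x]; last first.
      by rewrite inE => /andP[/negbTE->].
    rewrite !sumr_const -/a cardsD Ac -/a natrB; last first.
      by rewrite -Ac subset_leq_card // subsetIl.
    rewrite -[t *+ a]mulr_natl; field.
    by rewrite addrC natr1 pnatr_eq0.
  rewrite ler_wpM2l ?ler0n //.
  rewrite -mulrA; apply: bernoulli_inequality.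
  by rewrite divr_ge0 ?ler0n // subr_ge0.
- move=> h _ /(le_trans _); apply; apply: ler_sum => i _.
  by rewrite ler_peMr ?exprn_ge0 ?exprn_ege1.
Qed.

(** * Degrees in the complete graph *)

Lemma card_complete_graph_star n (v : 'I_n) :
  (#|complete_graph n :&: [set e : {set 'I_n} | v \in e]| <= n)%N.
Proof.
rewrite -[leqRHS]card_ord -cardsT.
apply: leq_trans (leq_imset_card (fun u => [set v; u]) _).
apply: subset_leq_card; apply/subsetP => e; rewrite !inE => /andP[/cards2P].
case=> x [y [xy ->]]; rewrite !inE => /orP[]/eqP->; apply/imsetP.
  by exists y; rewrite ?inE.
by exists x; rewrite ?inE // setUC.
Qed.

Lemma degreeE n (G : {set {set 'I_n}}) v :
  degree G v = #|G :&: [set e : {set 'I_n} | v \in e]|.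
Proof. by congr #|pred_of_set _|; apply/setP => e; rewrite !inE. Qed.

(** Apply the potential to the stars. With [s = (t - 1) / (q + 1)] it starts at most at
    [n * (1 + s) ^+ n <= n * expR (s * n)] and ends at least at its term for [v]; take
    logarithms. *)
Lemma client_can_ensure_degree (R : realType) (n q : nat) (t : R) :
  (0 < n)%N -> 1 < t ->
  client_can_ensure (complete_graph n) q (fun G => forall v,
    (degree G v)%:R * ln t <= ln n%:R + (t - 1) / q.+1%:R * n%:R).
Proof.
move=> n0 t1.
have x0 : {set 'I_n} by exact: set0.
case: (@client_can_ensure_exp R _ 'I_n (complete_graph n) q
  (fun v => [set e : {set 'I_n} | v \in e]) t x0 (ltW t1)) => sg [sgl sgP].
exists sg; split=> // h hl hg hf v; have {sgP hl hg hf} := sgP h hl hg hf.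
set G := client_claimed h => hG; rewrite degreeE.
set s := (t - 1) / _.
have s0 : 0 <= s by rewrite divr_ge0 ?ler0n // subr_ge0 ltW.
have t0 : 0 < t by apply: lt_trans t1.
have : t ^+ #|G :&: [set e : {set 'I_n} | v \in e]| <= n%:R * expR (s * n%:R).
  apply: (@le_trans _ _
      (\sum_(v < n) t ^+ #|G :&: [set e : {set 'I_n} | v \in e]|)).
    by rewrite (bigD1 v) //= lerDl sumr_ge0 // => w _; rewrite exprn_ge0 ?ltW.
  have -> : n%:R * expR (s * n%:R) = \sum_(w < n) expR (s * n%:R).
    by rewrite sumr_const card_ord mulr_natl.
  apply: le_trans hG _; apply: ler_sum => w _; rewrite expRM_natr.
  apply: (@le_trans _ _ ((1 + s) ^+ n)).
    by rewrite ler_weXn2l ?card_complete_graph_star // lerDl.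
  by rewrite lerXn2r ?nnegrE ?expR_ge0 ?expR_ge1Dx // addr_ge0.
rewrite -ler_ln ?posrE ?exprn_gt0 ?mulr_gt0 ?expR_gt0 ?ltr0n //.
by rewrite lnXn // lnM ?posrE ?expR_gt0 ?ltr0n // expRK mulr_natl.
Qed.

(** The vertices below [n./2] contain [k] consecutive blocks [I i] of length [b]; the boxes of a
    vertex [v] from the upper half are the edge sets from [v] to these blocks. *)
Lemma waiter_can_force_degree (n q k b g : nat) :
  (k * b <= n./2)%N -> (q < g * b)%N -> (g ^ k <= n - n./2)%N ->
  waiter_can_force (complete_graph n) q
    (fun G => exists v, (k <= degree G v)%N).
Proof.
move=> kb qgb gk; set m := n./2 in kb gk *.
have mn : (m <= n)%N by rewrite /m -divn2 leq_div.
pose I (i : nat) := [set u : 'I_n | i * b <= u < i.+1 * b]%N.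
pose J (v : 'I_n) i := [set [set v; u] | u in I i].
pose X0 := [set v : 'I_n | m <= v]%N.
have Ilt i u : (i < k)%N -> u \in I i -> (u < m)%N.
  move=> ik; rewrite inE => /andP[_ ui]; apply: leq_trans ui _.
  by apply: leq_trans kb; rewrite leq_mul2r ik orbT.
(* Since [u < m <= v], the edge determines which of its endpoints is which. *)
have pair_inj v w u u' i j : v \in X0 -> w \in X0 -> (i < k)%N -> (j < k)%N ->
    u \in I i -> u' \in I j -> [set v; u] = [set w; u'] -> v = w /\ u = u'.
  rewrite !inE => vm wm ik jk ui uj e.
  have um : (u < m)%N by apply: (Ilt i); rewrite ?inE.
  have um' : (u' < m)%N by apply: (Ilt j); rewrite ?inE.
  have : v \in [set w; u'] by rewrite -e set21.
  have : u \in [set w; u'] by rewrite -e set22.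
  rewrite !inE => /orP[/eqP uw|/eqP ->].
    by move: um; rewrite uw ltnNge wm.
  by case/orP => /eqP vE; [|move: um'; rewrite -vE ltnNge vm].
have card_nat_ord (lo hi : nat) : (hi <= n)%N ->
    #|[set u : 'I_n | lo <= u < hi]%N| = (hi - lo)%N.
  move=> hin; rewrite -sum1_card -[RHS]mul1n -[RHS]mulnC -sum_nat_const_nat.
  rewrite (big_nat_widen _ _ n) // (big_nat_widenl _ 0) // big_mkord.
  by apply: eq_bigl => u; rewrite inE andbC.
have [sg [sgl sgP]] : waiter_can_force (complete_graph n) q (fun G =>
    exists2 v, v \in X0 & (k <= #|G :&: \bigcup_(i < k) J v i|)%N).
  apply: (@waiter_can_force_box _ _ _ _ b g) => //.
  - move=> v i vX ik; split.
      apply/subsetP => _ /imsetP[u uI ->]; rewrite inE cards2.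
      have [vu|//] := eqVneq v u; move: (Ilt i u ik uI) vX.
      by rewrite inE -vu ltnNge => /negbTE->.
    rewrite card_in_imset => [|u u' uI uI' e].
      rewrite card_nat_ord; first by rewrite mulSn addnK.
      by apply: leq_trans mn; apply: leq_trans kb; rewrite leq_mul2r ik orbT.
    by have [] := pair_inj v v u u' i i vX vX ik ik uI uI' e.
  - move=> v w i j vX wX ik jk; apply: contraR => /pred0Pn[e] /=.
    case/andP => /imsetP[u uI ->] /imsetP[u' uJ e'].
    have [-> uu] := pair_inj _ _ _ _ _ _ vX wX ik jk uI uJ e'.
    rewrite xpair_eqE eqxx /=; move: uI uJ; rewrite -uu !inE.
    case/andP => i1 i2 /andP[j1 j2]; rewrite eqn_leq.
    have b0 : (0 < b)%N.
      by have := leq_ltn_trans (leq0n q) qgb; rewrite muln_gt0 => /andP[].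
    by rewrite -ltnS -(ltn_pmul2r b0) (leq_ltn_trans i1 j2) -ltnS
      -(ltn_pmul2r b0) (leq_ltn_trans j1 i2).
  - have -> : X0 = [set u : 'I_n | m <= u < n]%N.
      by apply/setP => u; rewrite !inE ltn_ord andbT.
    by rewrite card_nat_ord.
exists sg; split=> // h hl hg hf; have [v _ kv] := sgP h hl hg hf.
exists v; apply: leq_trans kv _; rewrite degreeE subset_leq_card // setIS //.
apply/bigcupsP => i _; apply/subsetP => _ /imsetP[u _ ->].
by rewrite !inE eqxx.
Qed.

(** Ensures blocks of length at least [n / (4 * k)]: the two roundings take less than [k + 1], hence
    less than [n / 4], away from [n / 2]. *)
Lemma half_divn_bound (n k : nat) :
  (0 < k)%N -> (4 * k.+1 <= n)%N -> (n <= 4 * k * (n./2 %/ k))%N.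
Proof.
move=> k0 nk; have := divn_eq n./2 k; have := ltn_pmod n./2 k0.
have := odd_double_half n; move: (n./2 %/ k)%N (n./2 %% k)%N => b c.
case: (odd n) => /=; nia.
Qed.

Lemma leq_div4_subn_half (n : nat) : (n %/ 4 <= n - n./2)%N.
Proof. lia. Qed.

(** * The threshold equation and both players' bounds for fixed [n] *)

Section Threshold.
Variables (R : realType) (n q : nat).
Hypothesis n2 : (2 <= n)%N.
Let f : R := wc_threshold R n q.
Let r : R := f * q.+1%:R / n%:R.

(** In logarithms, the condition inside the supremum reads [d * ln (d * Q / n) < ln n]. With
    [x = d * Q / n], equality means [x * ln x = Q * ln n / n], solvable by the intermediate value
    theorem; the set is then the open interval from [0] to [x * n / Q]. *)
Lemma wc_thresholdP : 1 < r /\ f * ln r = ln n%:R.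
Proof.
have n0 : 0 < n%:R :> R by rewrite ltr0n (ltn_trans _ n2).
have n1 : 1 < n%:R :> R by rewrite ltr1n.
have Q0 : 0 < q.+1%:R :> R by rewrite ltr0n.
have ln0 : 0 < ln n%:R :> R by rewrite ln_gt0.
pose L : R := q.+1%:R * ln n%:R / n%:R.
have L0 : 0 < L by rewrite divr_gt0 ?mulr_gt0.
(* The right end is far enough because [expR (1 + L) * (1 + L) >= L]. *)
have [x] : exists2 x, x \in `[1, expR (1 + L)] & x * ln x = L.
  apply: IVT; first by rewrite -expR0 ler_expR addr_ge0 // ltW.
    apply: continuous_in_subspaceT => x /set_mem /=.
    rewrite in_itv => /andP[x1 _].
    by apply: cvgM; [exact: cvg_id|apply: continuous_ln; apply: lt_le_trans x1].
  rewrite ln1 mulr0 expRK min_l ?max_r ?(ltW L0) /=.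
  - apply: (@le_trans _ _ (1 + L)); first by rewrite lerDr.
    by rewrite ler_peMl ?addr_ge0 ?(ltW L0) // -expR0 ler_expR addr_ge0 // ltW.
  - by rewrite mulr_ge0 ?expR_ge0 // addr_ge0 // ltW.
  - by rewrite mulr_ge0 ?expR_ge0 // addr_ge0 // ltW.
rewrite in_itv /= => /andP[x1 _] xL.
have {}x1 : 1 < x.
  rewrite lt_neqAle x1 andbT; apply: contraTneq L0 => x1'.
  by rewrite -xL -x1' ln1 mulr0 ltxx.
have lnx0 : 0 < ln x by rewrite ln_gt0.
have yx : x * n%:R / q.+1%:R * ln x = ln n%:R.
  have -> : x * n%:R / q.+1%:R * ln x = (x * ln x) * n%:R / q.+1%:R by ring.
  by rewrite xL /L; field; rewrite !gt_eqF.
have fE : f = x * n%:R / q.+1%:R.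
  have y0 : 0 < x * n%:R / q.+1%:R.
    by rewrite divr_gt0 ?mulr_gt0 // (lt_trans _ x1).
  rewrite /f /wc_threshold -[RHS](@sup_itv _ (BRight 0) true) //.
  congr (sup _); apply/seteqP.
  have key (d : R) : 0 < d -> ((d * q.+1%:R) `^ d < n%:R `^ (d + 1)) =
      (d * ln (d * q.+1%:R / n%:R) < ln n%:R).
    move=> d0; rewrite -[LHS]ltr_ln ?posrE ?powR_gt0 ?mulr_gt0 // !ln_powR.
    by rewrite ln_div ?posrE ?mulr_gt0 // mulrBr ltrBlDr mulrDl mul1r addrC.
  have xd (d : R) : (d < x * n%:R / q.+1%:R) = (d * q.+1%:R / n%:R < x).
    by rewrite ltr_pdivlMr // ltr_pdivrMr.
  split=> d /=; rewrite in_itv /=.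
    case=> d0; rewrite key // d0 /= => dn; rewrite ltNge; apply/negP => yd.
    move: dn; rewrite ltNge -yx => /negP; apply.
    apply: ler_pM => //; [exact: ltW|exact: ltW|].
    rewrite ler_ln ?posrE ?divr_gt0 ?mulr_gt0 ?(lt_trans _ x1) //.
    by rewrite leNgt -xd -leNgt.
  case/andP => d0 dy; split=> //; rewrite key // -yx.
  (* Both factors can be compared only where the logarithm is nonnegative; elsewhere the product is
     at most [0]. *)
  have [d1|d1] := leP (d * q.+1%:R / n%:R) 1.
    apply: (@le_lt_trans _ _ 0); last by rewrite mulr_gt0.
    by rewrite mulr_ge0_le0 ?ln_le0 // ltW.
  apply: ltr_pM; rewrite ?ln_ge0 ?(ltW d0) ?(ltW d1) //.
  by rewrite ltr_ln ?posrE -?xd // (lt_trans ltr01).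
have rE : r = x.
  by rewrite /r fE divfK ?mulfK ?gt_eqF.
by rewrite rE fE.
Qed.

Lemma wc_threshold_gt0 : 0 < f.
Proof.
have [r1 fr] := wc_thresholdP.
by rewrite -(pmulr_lgt0 _ (ln_gt0 r1)) fr ln_gt0 // ltr1n.
Qed.

(** Take [t = r]: then [ln n = f * ln r] and [(r - 1) * n / Q = f - n / Q <= f]. *)
Lemma client_can_ensure_threshold :
  client_can_ensure (complete_graph n) q (fun G => forall v,
    (degree G v)%:R <= (1 + (ln r)^-1) * f).
Proof.
have [r1 fr] := wc_thresholdP; have f0 := wc_threshold_gt0.
have n0 : (0 < n)%N by exact: ltn_trans n2.
have [sg [sgl sgP]] := client_can_ensure_degree q n0 r1.
exists sg; split=> // h hl hg hf v; have := sgP h hl hg hf v.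
have lr := ln_gt0 r1; rewrite -(ler_pdivlMr _ _ lr) => /le_trans; apply.
rewrite ler_pdivrMr // -fr.
have -> : (1 + (ln r)^-1) * f * ln r = f * ln r + f.
  by field; rewrite gt_eqF.
rewrite lerD2l.
have -> : (r - 1) / q.+1%:R * n%:R = f - n%:R / q.+1%:R.
  rewrite mulrAC mulrBl mul1r mulrBl /r.
  by rewrite divfK ?mulfK ?pnatr_eq0 // -lt0n.
by rewrite lerBlDr lerDl divr_ge0 ?ler0n.
Qed.

(* [8 * r] bounds the number of vertices that Waiter has to involve in one
   round. *)
Let k := Num.truncn (ln (n%:R / 4) / ln (8 * r)).


(** Used to keep Waiter's error term nonpositive, and to turn the block length bound [n / (4 * k)]
    into [n / (4 * f)]. *)
Lemma waiter_degree_le : k%:R <= f.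
Proof.
have [r1 fr] := wc_thresholdP; have f0 := wc_threshold_gt0.
have n0 : 0 < n%:R :> R by rewrite ltr0n (ltn_trans _ n2).
have lr := ln_gt0 r1; have r0 := lt_trans ltr01 r1.
have r80 : 0 < 8 * r by lra.
have lr8 : ln r <= ln (8 * r) by rewrite ler_ln ?posrE //; lra.
(* For [n < 4] the quotient is negative and truncates to [0]. *)
have [c0|c0] := ltP (ln (n%:R / 4) / ln (8 * r)) 0.
  suff -> : k = 0%N by rewrite ltW.
  by apply/eqP; rewrite -leqn0 real_truncn_le_nat ?num_real // (lt_trans c0).
apply: (@le_trans _ _ (ln (n%:R / 4) / ln (8 * r))); first by rewrite truncn_le.
rewrite ler_pdivrMr ?(lt_le_trans lr) //.
apply: (@le_trans _ _ (f * ln r)); last by rewrite ler_pM2l.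
by rewrite fr ler_ln ?posrE ?divr_gt0 //; lra.
Qed.

Lemma waiter_can_force_threshold :
  waiter_can_force (complete_graph n) q (fun G => exists v,
    (k <= degree G v)%N).
Proof.
have [r1 fr] := wc_thresholdP; have f0 := wc_threshold_gt0.
have n0 : 0 < n%:R :> R by rewrite ltr0n (ltn_trans _ n2).
have lr := ln_gt0 r1; have r0 := lt_trans ltr01 r1.
have kf := waiter_degree_le.
(* For [k = 0] the block length [n./2 %/ k] would be [0]; length [1] and [g = q + 1] do instead. *)
have [k0|k0] := posnP k.
  rewrite k0; apply: (@waiter_can_force_degree n q 0 1 q.+1) => //.
    by rewrite muln1.
  by rewrite expn0 subn_gt0 -divn2 ltn_Pdiv // (ltn_trans _ n2).
have r8 : 1 < 8 * r by lra.
have r80 := lt_trans ltr01 r8.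
have l8 : 0 < ln (8 * r) by rewrite ln_gt0.
have k8 : (8 * r) ^+ k <= n%:R / 4.
  rewrite -ler_ln ?posrE ?exprn_gt0 ?divr_gt0 // lnXn //.
  rewrite -[leLHS]mulr_natl -ler_pdivlMr // truncn_le.
  by move: k0; rewrite truncn_gt0; apply: le_trans.
(* By Bernoulli, [k + 1 <= (8 * r) ^+ k <= n / 4]. *)
have nk : (4 * k.+1 <= n)%N.
  rewrite -(ler_nat R) natrM mulrC -ler_pdivlMr //; apply: le_trans k8.
  have -> : 8 * r = 1 + (8 * r - 1) by ring.
  apply: le_trans (bernoulli_inequality k _); last by lra.
  rewrite -natr1 addrC lerD2l ler_peMr //; lra.
pose b := (n./2 %/ k)%N.
have b_ge : (n <= 4 * k * b)%N by exact: half_divn_bound.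
have b0 : (0 < b)%N.
  have := leq_trans (ltn_trans (ltn0Sn 0) n2) b_ge.
  by rewrite muln_gt0 => /andP[].
apply: (@waiter_can_force_degree n q k b (q %/ b).+1).
- by rewrite mulnC leq_divM.
- by rewrite ltn_ceil.
apply: leq_trans (leq_div4_subn_half n).
rewrite leq_divRL // -(ler_nat R) natrM natrX.
rewrite -ler_pdivlMr //; apply: le_trans k8.
rewrite lerXn2r ?nnegrE ?ler0n ?(ltW r80) // -natr1.
(* As [r > 1], the factor [8] leaves room for the [+ 1] in [g]. *)
suff : (q %/ b)%:R <= 4 * r by lra.
have bR : 0 < b%:R :> R by rewrite ltr0n.
apply: (@le_trans _ _ (q%:R / b%:R)).
  by rewrite ler_pdivlMr // -natrM ler_nat leq_divM.
rewrite ler_pdivrMr //.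
have : n%:R <= 4 * f * b%:R.
  apply: (@le_trans _ _ (4 * k * b)%:R); first by rewrite ler_nat.
  by rewrite !natrM ler_pM2r // ler_pM2l.
rewrite /r => nb; apply: (@le_trans _ _ q.+1%:R); first by rewrite ler_nat.
have -> : 4 * (f * q.+1%:R / n%:R) * b%:R = q.+1%:R * (4 * f * b%:R / n%:R).
  by ring.
by rewrite ler_peMr ?ler0n // ler_pdivlMr // mul1r.
Qed.

(** Since [f = ln n / ln r], the untruncated quotient over [f] is [(1 - ln 4 / ln n) * (1 - ln 8 /
    ln (8 * r))], whose cross term is nonnegative; truncation costs at most [1 / f]. *)
Lemma waiter_degree_ge :
  1 - ln 4 / ln n%:R - ln 8 / ln (8 * r) - f^-1 <= k%:R / f.
Proof.
have [r1 fr] := wc_thresholdP; have f0 := wc_threshold_gt0.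
have n1 : 1 < n%:R :> R by rewrite ltr1n.
have n0 := lt_trans ltr01 n1; have r0 := lt_trans ltr01 r1.
have lr := ln_gt0 r1; have ln0 := ln_gt0 n1.
have l4 : 0 < ln 4 :> R by rewrite ln_gt0 //; lra.
have l8 : 0 < ln 8 :> R by rewrite ln_gt0 //; lra.
have lr8 : ln (8 * r) = ln 8 + ln r by rewrite lnM ?posrE.
have lr80 : 0 < ln (8 * r) by rewrite lr8 addr_gt0.
apply: (@le_trans _ _ ((ln (n%:R / 4) / ln (8 * r) - 1) / f)); last first.
  rewrite ler_pM2r ?invr_gt0 // lerBlDr natr1; exact/ltW/truncnS_gt.
have fE : f = ln n%:R / ln r by rewrite -fr mulfK ?gt_eqF.
rewrite mulrBl mul1r lerD2r ln_div ?posrE // {}fE lr8.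
have -> : (ln n%:R - ln 4) / (ln 8 + ln r) / (ln n%:R / ln r) =
    (1 - ln 4 / ln n%:R) * (1 - ln 8 / (ln 8 + ln r)).
  by field; rewrite ?gt_eqF ?addr_gt0.
have : 0 <= ln 4 / ln n%:R * (ln 8 / (ln 8 + ln r)).
  by rewrite mulr_ge0 // divr_ge0 ?ltW ?addr_gt0.
lra.
Qed.
End Threshold.

(** * Asymptotics of the threshold *)

Local Open Scope classical_set_scope.
Local Open Scope ring_scope.

Section Asymptotics.
Variables (R : realType) (q : nat -> nat).
Hypothesis q_gt0 : forall n : nat, (0 < q n)%N.
Hypothesis q_omega : (q n)%:R * ln (n%:R : R) / n%:R @[n --> \oo] --> +oo.
Hypothesis q_exponent :
  ln ((q n)%:R : R) / ln (n%:R : R) @[n --> \oo] --> (1 : R).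
Let f n : R := wc_threshold R n (q n).
Let r n : R := f n * (q n).+1%:R / n%:R.

Lemma ln_natr_cvgy : ln (n%:R : R) @[n --> \oo] --> +oo.
Proof.
apply/cvgryPgt => A; near=> n.
have eA : expR A < n%:R.
  near: n; move/cvgryPgt : (@cvgr_idn R) => /(_ (expR A)).
  exact.
by rewrite -[A]expRK ltr_ln ?posrE ?expR_gt0 // (lt_trans _ eA) ?expR_gt0.
Unshelve. all: by end_near. Qed.

Lemma inv_cvgy0 (u : nat -> R) :
  u n @[n --> \oo] --> +oo -> (u n)^-1 @[n --> \oo] --> (0 : R).
Proof.
move=> u_oo; apply/gtr0_cvgV0 => //.
by near=> n; near: n; move/cvgryPgt : u_oo; exact.
Unshelve. all: by end_near. Qed.

Lemma inv_ln_natr_cvg0 : (ln (n%:R : R))^-1 @[n --> \oo] --> (0 : R).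
Proof. exact: inv_cvgy0 ln_natr_cvgy. Qed.

(** [r * ln r = (q + 1) * ln n / n] tends to infinity by [q_omega], whereas [r <= M] would bound it
    by [M * ln M]. *)
Lemma threshold_ratio_cvgy : r n @[n --> \oo] --> +oo.
Proof.
apply/cvgryPgt => A; pose M := Num.max A 1.
have M1 : 1 <= M by rewrite le_max lexx orbT.
near=> n.
have n2 : (2 <= n)%N by near: n; exists 2%N.
have [r1 fr] := wc_thresholdP R (q n) n2.
have n0 : 0 < n%:R :> R by rewrite ltr0n (ltn_trans _ n2).
have ln0 : 0 < ln n%:R :> R by rewrite ln_gt0 // ltr1n.
rewrite -/(f n) in fr r1; rewrite -/(r n) in fr r1.
have big : M * ln M < (q n)%:R * ln n%:R / n%:R.
  by near: n; move/cvgryPgt : q_omega; exact.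
apply: (@le_lt_trans _ _ M); first by rewrite le_max lexx.
rewrite ltNge; apply/negP => rM; move: big; rewrite ltNge => /negP; apply.
apply: (@le_trans _ _ (r n * ln (r n))).
  have -> : r n * ln (r n) = (q n).+1%:R * ln n%:R / n%:R.
    by rewrite -fr {1}/r; ring.
  by rewrite ler_pM2r ?invr_gt0 // ler_pM2r // ler_nat.
apply: ler_pM => //; [exact/ltW/(lt_trans ltr01)|by rewrite ln_ge0 // ltW|].
by rewrite ler_ln ?posrE // (lt_trans ltr01) // (lt_le_trans r1).
Unshelve. all: by end_near. Qed.

(** If [f <= M], then [r <= 2 * M * q / n] by [q + 1 <= 2 * q], so [ln n = f * ln r <= M * ln (2 * M
    * q / n)]. Divided by [ln n], the right side tends to [0] by [q_exponent]. *)
Lemma threshold_cvgy : f n @[n --> \oo] --> +oo.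
Proof.
have small (M : R) : 0 < M -> \forall n \near \oo,
    M * (ln (M * 2) / ln n%:R + (ln (q n)%:R / ln n%:R - 1)) < 1.
  move=> M0; apply: (cvgr_lt 0) => //.
  rewrite -(mulr0 M); apply: cvgM; first exact: cvg_cst.
  rewrite -[0]addr0; apply: cvgD.
    rewrite -(mulr0 (ln (M * 2))); apply: cvgM; first exact: cvg_cst.
    exact: inv_ln_natr_cvg0.
  rewrite -(subrr 1); apply: cvgB => //; exact: cvg_cst.
apply/cvgryPgt => A; pose M := Num.max A 1.
have M0 : 0 < M by rewrite lt_max ltr01 orbT.
near=> n.
have n2 : (2 <= n)%N by near: n; exists 2%N.
have [r1 fr] := wc_thresholdP R (q n) n2.
have f0 := wc_threshold_gt0 R (q n) n2.
have n0 : 0 < n%:R :> R by rewrite ltr0n (ltn_trans _ n2).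
have ln0 : 0 < ln n%:R :> R by rewrite ln_gt0 // ltr1n.
rewrite -/(f n) in fr r1 f0; rewrite -/(r n) in fr r1.
have sm : M * (ln (M * 2) / ln n%:R + (ln (q n)%:R / ln n%:R - 1)) < 1.
  by near: n; apply: small.
apply: (@le_lt_trans _ _ M); first by rewrite le_max lexx.
rewrite ltNge; apply/negP => fM; move: sm; rewrite ltNge => /negP; apply.
have q0 : 0 < (q n)%:R :> R by rewrite ltr0n.
have rle : r n <= M * 2 * (q n)%:R / n%:R.
  rewrite /r ler_pM2r ?invr_gt0 // -mulrA ler_pM ?(ltW f0) //.
  by rewrite -natrM ler_nat mul2n -addnn -addn1 leq_add2l.
rewrite -(ler_pM2r ln0) mul1r -[leLHS]fr.
apply: (@le_trans _ _ (M * ln (r n))).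
  by rewrite ler_pM2r // ln_gt0.
rewrite -mulrA ler_pM2l //.
have -> : (ln (M * 2) / ln n%:R + (ln (q n)%:R / ln n%:R - 1)) * ln n%:R =
    ln (M * 2 * (q n)%:R / n%:R).
  rewrite ln_div ?posrE ?mulr_gt0 //.
  by rewrite [ln (M * 2 * _)]lnM ?posrE ?mulr_gt0 //; field; rewrite gt_eqF.
by rewrite ler_ln ?posrE ?divr_gt0 ?mulr_gt0 // (lt_trans ltr01).
Unshelve. all: by end_near. Qed.
End Asymptotics.

(** * The error terms of both players *)

Theorem theorem1p3 (R : realType) (q : nat -> nat)
  (q_gt0 : forall n : nat, (0 < q n)%N)
  (q_omega : (q n)%:R * ln (n%:R : R) / n%:R @[n --> \oo] --> +oo)
  (q_exponent : ln ((q n)%:R : R) / ln (n%:R : R) @[n --> \oo] --> (1 : R)) :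
  exists eps1 eps2 : nat -> R,
    [/\ eps1 n @[n --> \oo] --> (0 : R),
        eps2 n @[n --> \oo] --> (0 : R)
      & forall n : nat, (2 <= n)%N ->
          waiter_can_force (complete_graph n) (q n)
            (fun G => exists v : 'I_n,
               (1 + eps1 n) * wc_threshold R n (q n) <= (degree G v)%:R)
          /\
          client_can_ensure (complete_graph n) (q n)
            (fun G => forall v : 'I_n,
               (degree G v)%:R <= (1 + eps2 n) * wc_threshold R n (q n))].
Proof.
pose f n : R := wc_threshold R n (q n).
pose r n : R := f n * (q n).+1%:R / n%:R.
pose k n := Num.truncn (ln (n%:R / 4) / ln (8 * r n)).
have r_oo : r n @[n --> \oo] --> +oo by exact: threshold_ratio_cvgy.
have f_oo : f n @[n --> \oo] --> +oo by exact: threshold_cvgy.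
have ln_oo (c : R) : 0 < c -> (ln (c * r n))^-1 @[n --> \oo] --> (0 : R).
  move=> c0; apply: inv_cvgy0; apply/cvgryPgt => A; near=> n.
  have rA : expR A / c < r n by near: n; move/cvgryPgt : r_oo; exact.
  rewrite ltr_pdivrMr // mulrC in rA.
  by rewrite -[A]expRK ltr_ln ?posrE ?expR_gt0 // (lt_trans _ rA) ?expR_gt0.
(* The first choice makes [(1 + eps1) * f] equal to [k], the degree Waiter forces; the second is
   Client's exact error. *)
exists (fun n => (k n)%:R / f n - 1), (fun n => (ln (r n))^-1); split.
- apply: (@squeeze_cvgr _ _ _ _
    (fun n => - (ln 4 * (ln n%:R)^-1 + ln 8 * (ln (8 * r n))^-1 + (f n)^-1))
    (fun=> 0)).
  + near=> n; have n2 : (2 <= n)%N by near: n; exists 2%N.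
    have f0 := wc_threshold_gt0 R (q n) n2.
    rewrite subr_le0 ler_pdivrMr // mul1r (waiter_degree_le R (q n) n2) andbT.
    have := waiter_degree_ge R (q n) n2.
    by rewrite -/(f n) -/(r n) -/(k n); lra.
  + have : - (ln 4 * 0 + ln 8 * 0 + 0) = 0 :> R by ring.
    move=> zeroE; rewrite -[X in _ --> X]zeroE.
    apply: cvgN; apply: cvgD; last exact: inv_cvgy0.
    apply: cvgD; apply: cvgM; (try exact: cvg_cst); last exact: ln_oo.
    exact: inv_ln_natr_cvg0.
  + exact: cvg_cst.
- under eq_fun do rewrite -[r _]mul1r; exact: ln_oo.
move=> n n2; split; last exact: client_can_ensure_threshold.
have f0 := wc_threshold_gt0 R (q n) n2.
have [sg [sgl sgP]] := waiter_can_force_threshold R (q n) n2.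
exists sg; split=> // h hl hg hf; have [v kv] := sgP h hl hg hf.
exists v; rewrite addrC subrK divfK ?gt_eqF // ler_nat; exact: kv.
Unshelve. all: by end_near. Qed.
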